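(* Let $\mathcal{G}$ be the class of all finite groups. The function $\psi'':\mathcal{G}\longrightarrow(0,1]$, $G\mapsto\psi''(G)$, is not injective (groups being considered up to isomorphism); that is, there exist finite groups $G_1$ and $G_2$ with $G_1\not\cong G_2$ and $\psi''(G_1)=\psi''(G_2)$.
   Context: For a finite group $G$ and $x\in G$, $o(x)$ denotes the order of $x$. The sum of element orders of $G$ is $\psi(G)=\sum_{x\in G}o(x)$, and $\psi''(G)=\frac{\psi(G)}{|G|^2}$. One has $\psi''(G)\in(0,1]$ for every finite group $G$. *)

(* Defs.v *)
From mathcomp Require Import all_boot all_order all_algebra all_fingroup.
Set Implicit Arguments.
Unset Strict Implicit.
Unset Printing Implicit Defensive.
Import Order.TTheory GRing.Theory Num.Theory.

Definition psi (gT : finGroupType) (G : {group gT}) : nat :=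
  (\sum_(x in G) #[x]%g)%N.

Definition psi'' (gT : finGroupType) (G : {group gT}) : rat :=
  ((psi G)%:R / #|G|%:R ^+ 2)%R.

Lemma psi''_gt0_le1 (gT : finGroupType) (G : {group gT}) :
  (0 < psi'' G <= 1)%R.
Proof.
have G0 : (0 < #|G|%:R :> rat)%R by rewrite ltr0n cardG_gt0.
have psi0 : (0 < psi G)%N.
  by rewrite /psi (bigD1 1%g) ?group1 //= order1.
have psi_le : (psi G <= #|G| ^ 2)%N.
  rewrite /psi -mulnn -sum_nat_const; apply: leq_sum => x Gx.
  by rewrite subset_leq_card ?cycle_subG.
rewrite /psi'' divr_gt0 ?ltr0n ?exprn_gt0 //=.
by rewrite ler_pdivrMr ?exprn_gt0 // mul1r -natrX ler_nat.
Qed.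

(* Main.v *)
Require Import Defs.
From mathcomp Require Import all_boot all_order all_algebra all_fingroup.
From mathcomp Require Import abelian maximal extraspecial mxabelem.

(** In a group of prime exponent p every nontrivial element has order p, so psi
    depends only on the order of the group. For odd p the extraspecial group
    p^{1+2} and the elementary abelian group of order p^3 both have exponent p,
    but only the latter is abelian; the theorem takes p = 3. *)

Lemma psi_prime_exponent (gT : finGroupType) (G : {group gT}) (p : nat) :
  prime p -> exponent G %| p -> psi G = (#|G|.-1 * p).+1.
Proof.
move=> p_pr expG.
(* The identity, of order 1, gives the outer successor; the other [#|G|.-1] elements contribute [p]
   each. *)
rewrite /psi (big_setD1 1%g) ?group1 //= order1 add1n (cardsD1 1%g G) group1.
rewrite -sum_nat_const; congr _.+1; apply: eq_bigr => x /setD1P[nt_x Gx].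
apply: prime_nt_dvdP; rewrite ?order_eq1 //.
exact: dvdn_trans (dvdn_exponent Gx) expG.
Qed.

Theorem proposition1p5 :
  exists (gT1 gT2 : finGroupType) (G1 : {group gT1}) (G2 : {group gT2}),
    ~ (G1 \isog G2)%g /\ psi'' G1 = psi'' G2.
Proof.
have p3 : prime 3 by [].
(* Commutativity will rule out an isomorphism; the exponent bound will determine [psi]. *)
have /andP[abE expE] : abelian [set: 'rV['F_3]_3] && (exponent [set: 'rV['F_3]_3] %| 3).
  by rewrite -abelemE // mx_Fp_abelem.
have cardE : #|[set: 'rV['F_3]_3]| = 3 ^ 3 by rewrite cardsT card_mx card_Fp.
exists (3^{1+2})%type, 'rV['F_3]_3, [set: 3^{1+2}]%G, [set: 'rV['F_3]_3]%G; split.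
  move=> /isog_abelian; rewrite abE.
  by apply/negP; apply/extraspecial_nonabelian/pX1p2_extraspecial.
(* [exponent_pX1p2] requires an odd prime: for p = 2 the group [p^{1+2}] has exponent 4. Only the
   orders, both 27, remain to be compared. *)
rewrite /psi'' !(psi_prime_exponent _ _ 3) ?exponent_pX1p2 //.
by rewrite cardE card_pX1p2.
Qed.
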